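(* Let $h(y)$ be a delta series and $l(y)$ an invertible series over $\mathbb{C}$, and let $\{{}_sA_n(x)\}_{n\ge 0}$ be the Sheffer-Appell polynomial sequence for the pair $(l(y),h(y))$. Then for every integer $n\ge 0$, $${}_sA_{n+1}(x)\,a_0=x\,{}_sA_n(x)+\sum_{k=0}^{n}\binom{n}{k}\,{}_sA_{n-k}(x)\,(b_k+c_k)-\sum_{k=1}^{n}\binom{n}{k}\,{}_sA_{n+1-k}(x)\,a_k,$$ where, for $k\ge 0$, $$a_k=\left(h'(h^{-1}(y))\right)^{(k)}\Big|_{y=0},\qquad b_k=\left(-\frac{h'(h^{-1}(y))\,l'(y)}{l(y)}\right)^{(k)}\Bigg|_{y=0},\qquad c_k=\left(-\frac{l'(h^{-1}(y))}{l(h^{-1}(y))}\right)^{(k)}\Bigg|_{y=0}.$$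
   Context: All series are power series in $y$ over $\mathbb{C}$, of the form $\sum_{r\ge 0}\alpha_r y^r/r!$. A delta series is a power series $h(y)$ with $h(0)=0$ and $h'(0)\neq 0$; an invertible series is a power series $l(y)$ with $l(0)\neq 0$. $h^{-1}(y)$ denotes the compositional inverse of $h(y)$, i.e. $h^{-1}(h(y))=h(h^{-1}(y))=y$. The Sheffer-Appell polynomial sequence $\{{}_sA_n(x)\}_{n\ge0}$ for the pair $(l(y),h(y))$, written ${}_sA_n(x)\sim(l(y),h(y))$, is defined by the generating function $$\frac{1}{l(h^{-1}(y))\,l(y)}\,e^{x h^{-1}(y)}=\sum_{n=0}^{\infty}{}_sA_n(x)\,\frac{y^n}{n!}.$$ For a series $g(y)$, $(g(y))^{(k)}|_{y=0}$ denotes its $k$th derivative with respect to $y$ evaluated at $y=0$; $h'(h^{-1}(y))$ and $l'(h^{-1}(y))$ mean $h'$ and $l'$ evaluated at $h^{-1}(y)$. *)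

(* Defs.v *)
From HB Require Import structures.
From mathcomp Require Import all_boot all_order all_algebra.
From mathcomp Require Import boolp.

Set Implicit Arguments.
Unset Strict Implicit.
Unset Printing Implicit Defensive.

Import GRing.Theory.
Local Open Scope ring_scope.

(* Formal power series in one variable [y]: [f n] is the ordinary coefficient of [y ^ n], so that a series written
   [\sum_r alpha_r y^r / r!] has [f r = alpha_r / r!]. *)
Record fps (K : Type) := Fps { fps_coef :> nat -> K }.

Lemma fpsP (K : Type) (f g : fps K) : (forall n, f n = g n) <-> f = g.
Proof.
split=> [|-> //]; case: f g => [f] [g] /= fg.
by congr Fps; apply/funext.
Qed.

HB.instance Definition _ (K : Type) := gen_eqMixin (fps K).
HB.instance Definition _ (K : Type) := gen_choiceMixin (fps K).

Section FpsRing.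
Variable K : comNzRingType.
Implicit Types (f g : fps K) (c : K).

Definition fps_zero : fps K := Fps (fun=> 0).
Definition fps_opp f : fps K := Fps (fun n => - f n).
Definition fps_add f g : fps K := Fps (fun n => f n + g n).

Fact fps_addA : associative fps_add.
Proof. by move=> f g h; apply/fpsP => n; rewrite /= addrA. Qed.
Fact fps_addC : commutative fps_add.
Proof. by move=> f g; apply/fpsP => n; rewrite /= addrC. Qed.
Fact fps_add0 : left_id fps_zero fps_add.
Proof. by move=> f; apply/fpsP => n; rewrite /= add0r. Qed.
Fact fps_addN : left_inverse fps_zero fps_opp fps_add.
Proof. by move=> f; apply/fpsP => n; rewrite /= addNr. Qed.

HB.instance Definition _ := GRing.isZmodule.Build (fps K)
  fps_addA fps_addC fps_add0 fps_addN.

Definition fpsC c : fps K := Fps (fun n => if n == 0%N then c else 0).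
Definition fps_mul f g : fps K :=
  Fps (fun n => \sum_(i < n.+1) f i * g (n - i)%N).

Definition fps_trunc N f : {poly K} := \poly_(i < N) f i.

Lemma coef_fps_mul N f g n : (n < N)%N ->
  fps_mul f g n = (fps_trunc N f * fps_trunc N g)`_n.
Proof.
move=> nN; rewrite coefM; apply: eq_bigr => i _; rewrite !coef_poly.
by rewrite (leq_ltn_trans _ nN) ?leq_ord// (leq_ltn_trans _ nN) ?leq_subr.
Qed.

Fact fps_mulA : associative fps_mul.
Proof.
move=> f g h; apply/fpsP => n.
transitivity ((fps_trunc n.+1 f * (fps_trunc n.+1 g * fps_trunc n.+1 h))`_n).
  rewrite coefM; apply: eq_bigr => i _; rewrite coef_poly ltn_ord.
  by congr (_ * _); apply: coef_fps_mul; rewrite ltnS leq_subr.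
rewrite mulrA coefM; apply: eq_bigr => i _.
rewrite -coef_fps_mul ?ltn_ord// coef_poly.
by rewrite ltnS leq_subr.
Qed.

Fact fps_mulC : commutative fps_mul.
Proof.
by move=> f g; apply/fpsP => n; rewrite !(@coef_fps_mul n.+1)// mulrC.
Qed.

Fact fps_mul1 : left_id (fpsC 1) fps_mul.
Proof.
move=> f; apply/fpsP => n /=; rewrite big_ord_recl /= mul1r subn0 big1 ?addr0//.
by move=> i _; rewrite mul0r.
Qed.

Fact fps_mulDl : left_distributive fps_mul +%R.
Proof.
move=> f g h; apply/fpsP => n /=; rewrite -big_split /=.
by apply: eq_bigr => i _; rewrite mulrDl.
Qed.

Fact fps_1_neq0 : fpsC 1 != 0.
Proof.
by apply/eqP => /fpsP /(_ 0%N) /= /eqP; rewrite oner_eq0.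
Qed.

HB.instance Definition _ := GRing.Zmodule_isComNzRing.Build (fps K)
  fps_mulA fps_mulC fps_mul1 fps_mulDl fps_1_neq0.

Definition fpsX : fps K := Fps (fun n => (n == 1%N)%:R).

Definition fps_deriv f : fps K := Fps (fun n => f n.+1 *+ n.+1).

(* The intended meaning is [f (g y)], for [g 0 = 0]; the terms [k > n] of
   [\sum_k f k * g ^+ k] then contribute nothing to the coefficient of
   [y ^ n]. *)
Definition fps_comp f g : fps K :=
  Fps (fun n => \sum_(k < n.+1) f k * (g ^+ k) n).

(* [f^(k)] evaluated at [y = 0] *)
Definition fps_deriv0 k f : K := iter k fps_deriv f 0%N.

Lemma fps_coef0 n : (0 : fps K) n = 0. Proof. by []. Qed.
Lemma fps_coef1 n : (1 : fps K) n = (n == 0%N)%:R.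
Proof. by rewrite /= ; case: eqP. Qed.
Lemma fps_coefC c n : fpsC c n = if n == 0%N then c else 0. Proof. by []. Qed.
Lemma fps_coefX n : fpsX n = (n == 1%N)%:R. Proof. by []. Qed.
Lemma fps_coefD f g n : (f + g) n = f n + g n. Proof. by []. Qed.
Lemma fps_coefN f n : (- f) n = - f n. Proof. by []. Qed.
Lemma fps_coefB f g n : (f - g) n = f n - g n. Proof. by []. Qed.
Lemma fps_coefM f g n : (f * g) n = \sum_(i < n.+1) f i * g (n - i)%N.
Proof. by []. Qed.
Lemma fps_coef_deriv f n : fps_deriv f n = f n.+1 *+ n.+1. Proof. by []. Qed.
Lemma fps_coef_comp f g n :
  fps_comp f g n = \sum_(k < n.+1) f k * (g ^+ k) n.
Proof. by []. Qed.

Lemma fps_coef_sum (I : Type) (r : seq I) (P : pred I) (F : I -> fps K) n :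
  (\sum_(i <- r | P i) F i) n = \sum_(i <- r | P i) F i n.
Proof.
by elim/big_rec2: _ => [|i x y _ <-].
Qed.

Lemma fps_coefCM c f n : (fpsC c * f) n = c * f n.
Proof.
rewrite fps_coefM big_ord_recl subn0 /= big1 ?addr0// => i _.
by rewrite mul0r.
Qed.

Lemma fps_coefM0 f g : (f * g) 0%N = f 0%N * g 0%N.
Proof. by rewrite fps_coefM big_ord1. Qed.

End FpsRing.

Arguments fpsX {K}.

Section FpsInverse.
Variable K : comUnitRingType.
Implicit Types (f g h : fps K).

(* Successive approximation, one coefficient at a time, of a solution [g] of
   [Phi g = t]; [u] is the inverse of the factor by which the coefficient of
   [y ^ n] in [Phi g] depends on that of [y ^ n] in [g]. *)
Fixpoint fps_approx (u : K) (t : fps K) (Phi : fps K -> fps K) n : fps K :=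
  if n is m.+1 then
    let g := fps_approx u t Phi m in
    Fps (fun i => if i == m then u * (t m - Phi g m) else g i)
  else 0.
Definition fps_solve u t Phi : fps K :=
  Fps (fun n => fps_approx u t Phi n.+1 n).

Definition fps_unit : {pred fps K} := fun f => f 0%N \is a GRing.unit.
Definition fps_inv f : fps K :=
  if f \in fps_unit then fps_solve (f 0%N)^-1 1 (fun g => f * g) else f.

(* The compositional inverse of a delta series [h]: see [fps_compinvK] and
   [compinv_fpsK]. *)
Definition fps_compinv h : fps K :=
  fps_solve (h 1%N)^-1 fpsX (fun g => fps_comp h g).

Lemma fps_approx_high u t Phi n i : (n <= i)%N -> fps_approx u t Phi n i = 0.
Proof.
elim: n => [//|n IHn] ni /=.
by rewrite gtn_eqF// IHn// ltnW.
Qed.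

Lemma fps_solve_low u t Phi n i : (i < n)%N ->
  fps_solve u t Phi i = fps_approx u t Phi n i.
Proof.
elim: n => [//|n IHn]; rewrite ltnS leq_eqVlt => /predU1P[->//|iltn].
by rewrite IHn //= ltn_eqF.
Qed.

Lemma fps_solveE u t Phi n :
  fps_solve u t Phi n = u * (t n - Phi (fps_approx u t Phi n) n).
Proof. by rewrite /= eqxx. Qed.

Fact fps_mulVx : {in fps_unit, left_inverse 1 fps_inv *%R}.
Proof.
move=> f fU; rewrite /fps_inv fU; set g := fps_solve _ _ _.
rewrite mulrC; apply/fpsP => n.
set a := fps_approx (f 0%N)^-1 1 (fun g => f * g) n.
have an : a n = 0 by exact: fps_approx_high.
have E : (f * a) n = \sum_(i < n) f (lift ord0 i) * g (n - (lift ord0 i))%N.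
  rewrite fps_coefM big_ord_recl subn0 an mulr0 add0r.
  apply: eq_bigr => -[i ni] _ /=; rewrite /bump /= add1n.
  by rewrite -(@fps_solve_low _ _ _ n)// subnS prednK ?leq_subr// subn_gt0.
rewrite fps_coefM big_ord_recl subn0 -E {1}/g fps_solveE -/a.
by rewrite mulVKr// subrK.
Qed.

Fact fps_unitPl f g : g * f = 1 -> fps_unit f.
Proof.
move=> /fpsP /(_ 0%N); rewrite fps_coefM0 fps_coef1 eqxx => gf.
by apply/unitrP; exists (g 0%N); rewrite [f 0%N * _]mulrC gf.
Qed.

Fact fps_inv_out : {in [predC fps_unit], fps_inv =1 id}.
Proof. by move=> f; rewrite inE /fps_inv => /negbTE ->. Qed.

HB.instance Definition _ := GRing.ComNzRing_hasMulInverse.Build (fps K)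
  fps_mulVx fps_unitPl fps_inv_out.

Lemma fps_unitE f : (f \is a GRing.unit) = (f 0%N \is a GRing.unit).
Proof. by []. Qed.

End FpsInverse.

Section FpsComp.
Variable K : comNzRingType.
Implicit Types (f g h : fps K).

Definition eqfps N f g := forall i, (i < N)%N -> f i = g i.

Lemma eqfpsM N f f' g g' :
  eqfps N f f' -> eqfps N g g' -> eqfps N (f * g) (f' * g').
Proof.
move=> ff gg n nN; rewrite !fps_coefM; apply: eq_bigr => i _.
rewrite ff ?gg//; first by rewrite (leq_ltn_trans _ nN)// leq_subr.
by rewrite (leq_ltn_trans _ nN)// leq_ord.
Qed.

Lemma eqfpsX N f f' k : eqfps N f f' -> eqfps N (f ^+ k) (f' ^+ k).
Proof.
by move=> ff; elim: k => [//|k IHk]; rewrite !exprS; apply: eqfpsM.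
Qed.

Lemma fps_expr_low g k n : g 0%N = 0 -> (n < k)%N -> (g ^+ k) n = 0.
Proof.
move=> g0; elim: k n => [//|k IHk] n nk.
rewrite exprS fps_coefM big_ord_recl g0 mul0r add0r big1// => -[i ni] _ /=.
rewrite /bump /= add1n IHk ?mulr0// subnS.
have : (n - i <= n)%N by rewrite leq_subr.
have : (0 < n - i)%N by rewrite subn_gt0.
by case: (n - i)%N => //= m _ mn; exact: leq_trans mn nk.
Qed.

Lemma eqfps_expr_next f g n k : f 0%N = 0 -> g 0%N = 0 -> eqfps n.+1 f g ->
  (f ^+ k.+2) n.+1 = (g ^+ k.+2) n.+1.
Proof.
move=> f0 g0 fg; rewrite exprS [in RHS]exprS !fps_coefM.
rewrite [LHS]big_ord_recl [RHS]big_ord_recl f0 g0 !mul0r.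
congr (_ + _); apply: eq_bigr => i _; rewrite lift0 subSS.
have := ltn_ord i; rewrite ltnS leq_eqVlt => /predU1P[->|ni].
  by rewrite subnn !fps_expr_low// !mulr0.
rewrite fg ?ltnS//; congr (_ * _); apply: (@eqfpsX n.+1) => //.
by rewrite ltnS leq_subr.
Qed.

Lemma fps_compE N f g n : g 0%N = 0 -> (n < N)%N ->
  fps_comp f g n = (\sum_(k < N) fpsC (f k) * g ^+ k) n.
Proof.
move=> g0 nN; rewrite fps_coef_sum fps_coef_comp.
under [RHS]eq_bigr => i _ do rewrite fps_coefCM.
rewrite (big_ord_widen_cond N xpredT (fun k => f k * (g ^+ k) n))//.
rewrite [RHS](bigID (fun i : 'I_N => (i < n.+1)%N)) /=.
rewrite [X in _ + X]big1 ?addr0// => i; rewrite -leqNgt => ni.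
by rewrite fps_expr_low// mulr0.
Qed.

Lemma fps_comp_next h f g n : f 0%N = 0 -> g 0%N = 0 -> eqfps n.+1 f g ->
  g n.+1 = 0 ->
  fps_comp h f n.+1 = h 1%N * f n.+1 + fps_comp h g n.+1.
Proof.
move=> f0 g0 fg gn.
have split_comp k : fps_comp h k n.+1 = h 0%N * (k ^+ 0) n.+1 +
    (h 1%N * k n.+1 + \sum_(i < n) h i.+2 * (k ^+ i.+2) n.+1).
  by rewrite fps_coef_comp big_ord_recl big_ord_recl; congr (_ + (_ + _)).
rewrite (split_comp f) (split_comp g) gn (mulr0 (h 1%N)).
rewrite (add0r (\sum_(i < n) _)).
rewrite [RHS]addrCA; under eq_bigr => i _ do
  rewrite (eqfps_expr_next _ f0 g0 fg).
by [].
Qed.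

Lemma fps_comp0 f g : fps_comp f g 0%N = f 0%N.
Proof. by rewrite fps_coef_comp big_ord1 expr0 fps_coef1 eqxx mulr1. Qed.

Lemma fps_compDl f g h : fps_comp (f + g) h = fps_comp f h + fps_comp g h.
Proof.
apply/fpsP => n; rewrite fps_coefD !fps_coef_comp -big_split /=.
by apply: eq_bigr => i _; rewrite mulrDl.
Qed.

Lemma fps_comp0l h : fps_comp 0 h = 0.
Proof.
by apply/fpsP => n; rewrite fps_coef_comp big1// => i _; rewrite mul0r.
Qed.

Lemma fps_comp1 h : fps_comp 1 h = 1.
Proof.
apply/fpsP => n; rewrite fps_coef_comp big_ord_recl fps_coef1 eqxx mul1r expr0.
by rewrite big1 ?addr0// => i _; rewrite mul0r.
Qed.

Lemma fps_compCM c f h : fps_comp (fpsC c * f) h = fpsC c * fps_comp f h.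
Proof.
apply/fpsP => n; rewrite fps_coefCM !fps_coef_comp mulr_sumr.
by apply: eq_bigr => i _; rewrite fps_coefCM mulrA.
Qed.

Lemma fps_comp_suml (I : Type) (r : seq I) (P : pred I) (F : I -> fps K) h :
  fps_comp (\sum_(i <- r | P i) F i) h = \sum_(i <- r | P i) fps_comp (F i) h.
Proof.
by elim/big_rec2: _ => [|i x y _ <-]; rewrite ?fps_comp0l// fps_compDl.
Qed.

Lemma fps_comp_eql N f f' h : eqfps N f f' ->
  eqfps N (fps_comp f h) (fps_comp f' h).
Proof.
move=> ff n nN; rewrite !fps_coef_comp; apply: eq_bigr => i _.
by rewrite ff// (leq_ltn_trans _ nN)// leq_ord.
Qed.

Lemma fps_compXl h : h 0%N = 0 -> fps_comp fpsX h = h.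
Proof.
move=> h0; apply/fpsP => n; rewrite (@fps_compE n.+2)// fps_coef_sum.
under eq_bigr => i _ do rewrite fps_coefCM fps_coefX.
rewrite !big_ord_recl /= mul0r add0r mul1r big1 ?addr0// => i _.
by rewrite mul0r.
Qed.

Lemma fps_coefXn k n : ((fpsX : fps K) ^+ k) n = (n == k)%:R.
Proof.
elim: k n => [|k IHk] n; first by rewrite expr0 fps_coef1.
rewrite exprS fps_coefM; case: n => [|n].
  by rewrite big_ord1 fps_coefX mul0r.
rewrite !big_ord_recl !fps_coefX /= mul0r add0r mul1r big1 ?addr0.
  by rewrite /bump /= subSS subn0 IHk.
by move=> i _; rewrite mul0r.
Qed.

Lemma fps_compXr h : fps_comp h fpsX = h.
Proof.
apply/fpsP => n; rewrite fps_coef_comp big_ord_recr /= big1 ?add0r.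
  by rewrite fps_coefXn eqxx mulr1.
by move=> i _; rewrite fps_coefXn gtn_eqF ?mulr0.
Qed.

Lemma fps_compM f g h : h 0%N = 0 ->
  fps_comp (f * g) h = fps_comp f h * fps_comp g h.
Proof.
move=> h0; apply/fpsP => n.
pose ev (p : {poly K}) := \sum_(k < size p) fpsC p`_k * h ^+ k.
have evN N (p : {poly K}) : (size p <= N)%N -> ev p = \sum_(k < N) fpsC p`_k * h ^+ k.
  move=> pN; rewrite /ev.
  rewrite (big_ord_widen_cond N xpredT (fun k => fpsC p`_k * h ^+ k))//.
  rewrite [RHS](bigID (fun i : 'I_N => (i < size p)%N)) /=.
  rewrite [X in _ + X]big1 ?addr0// => i; rewrite -leqNgt => ni.
  rewrite nth_default//; apply/fpsP => m.
  by rewrite fps_coefCM mul0r.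
have evD (p q : {poly K}) : ev (p + q) = ev p + ev q.
  pose N := maxn (size p) (size q).
  rewrite !(evN N) ?leq_maxl ?leq_maxr ?(size_polyD p q)//.
  rewrite -big_split /=; apply: eq_bigr => i _; apply/fpsP => m.
  by rewrite fps_coefD !fps_coefCM coefD mulrDl.
have ev0 : ev 0 = 0 by rewrite /ev size_poly0 big_ord0.
have evMX (p : {poly K}) : ev (p * 'X) = ev p * h.
  have sz : (size (p * 'X)%R <= (size p).+1)%N.
    by rewrite (leq_trans (size_polyMleq _ _))// size_polyX addn2.
  rewrite (evN _ _ sz) big_ord_recl coefMX /= mulr_suml.
  rewrite [X in X + _](_ : _ = 0) ?add0r; last first.
    by apply/fpsP => m; rewrite fps_coefCM mul0r.
  by apply: eq_bigr => i _; rewrite coefMX /= exprSr mulrA.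
have evC c : ev c%:P = fpsC c.
  by rewrite (evN 1%N) ?size_polyC ?leq_b1// big_ord1 coefC eqxx expr0 mulr1.
have evCM c (q : {poly K}) : ev (c%:P * q) = fpsC c * ev q.
  have sz : (size (c%:P * q)%R <= size q)%N.
    by rewrite mul_polyC size_scale_leq.
  rewrite (evN _ _ sz) /ev mulr_sumr; apply: eq_bigr => i _.
  by apply/fpsP => m; rewrite mulrA -mulrA !fps_coefCM coefCM mulrA.
have evM (p q : {poly K}) : ev (p * q) = ev p * ev q.
  elim/poly_ind: p => [|p c IHp]; first by rewrite mul0r ev0 mul0r.
  rewrite mulrDl !evD evC mulrDl evCM evMX; congr (_ + _).
  by rewrite -mulrA -['X * q]mulrC mulrA evMX IHp mulrAC.
have compev (f' : fps K) (p : {poly K}) : (forall i, (i < n.+1)%N -> f' i = p`_i) ->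
    eqfps n.+1 (fps_comp f' h) (ev p).
  move=> f'p i ni; rewrite (@fps_compE n.+1)//.
  rewrite (evN (maxn n.+1 (size p))) ?leq_maxr//.
  rewrite !fps_coef_sum.
  under eq_bigr => j _ do rewrite fps_coefCM.
  under [RHS]eq_bigr => j _ do rewrite fps_coefCM.
  rewrite (big_ord_widen_cond (maxn n.+1 (size p)) xpredT
             (fun k => f' k * (h ^+ k) i)) ?leq_maxl//=.
  rewrite [RHS](bigID (fun j : 'I__ => (j < n.+1)%N)) /=.
  rewrite [X in _ + X]big1 ?addr0.
    by apply: eq_bigr => j jn; rewrite f'p.
  move=> j; rewrite -leqNgt => nj; rewrite fps_expr_low ?mulr0//.
  exact: leq_trans ni nj.
have truncP f' i : (i < n.+1)%N -> f' i = (fps_trunc n.+1 f')`_i.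
  by move=> ni; rewrite coef_poly ni.
rewrite (compev (f * g) (fps_trunc n.+1 f * fps_trunc n.+1 g))//; last first.
  by move=> i ni; exact: coef_fps_mul.
rewrite evM; apply: (@eqfpsM n.+1) => // i ni; apply/esym/compev => //;
  exact: truncP.
Qed.

Lemma fps_compXn f h k : h 0%N = 0 -> fps_comp (f ^+ k) h = fps_comp f h ^+ k.
Proof.
move=> h0; elim: k => [|k IHk]; first by rewrite !expr0 fps_comp1.
by rewrite !exprS fps_compM// IHk.
Qed.

Lemma fps_compA f g h : g 0%N = 0 -> h 0%N = 0 ->
  fps_comp f (fps_comp g h) = fps_comp (fps_comp f g) h.
Proof.
move=> g0 h0; apply/fpsP => n.
rewrite (@fps_compE n.+1) ?fps_comp0//.
rewrite (@fps_comp_eql n.+1 (fps_comp f g)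
           (\sum_(k < n.+1) fpsC (f k) * g ^+ k))//; last first.
  by move=> i ni; rewrite (@fps_compE n.+1).
rewrite fps_comp_suml; congr (fps_coef _ n); apply: eq_bigr => i _.
by rewrite fps_compCM fps_compXn.
Qed.

End FpsComp.

Section FpsCompinv.
Variable K : fieldType.
Implicit Types (f g h l : fps K).

Definition delta_series h := h 0%N = 0 /\ h 1%N != 0.
Definition invertible_series l := l 0%N != 0.

Lemma fps_compinv0 h : delta_series h -> fps_compinv h 0%N = 0.
Proof.
by case=> h0 _; rewrite fps_solveE fps_coefX sub0r fps_comp0 h0 oppr0 mulr0.
Qed.

Lemma fps_compinvK h : delta_series h -> fps_comp h (fps_compinv h) = fpsX.
Proof.
move=> hD; have [h0 h1] := hD; apply/fpsP => n.
have g0 := fps_compinv0 hD; set g := fps_compinv h in g0 *.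
pose a := fps_approx (h 1%N)^-1 fpsX (fun g => fps_comp h g) n.
case: n => [|n] in a *; first by rewrite fps_comp0 h0.
have ag : eqfps n.+1 g a by move=> i ni; exact: fps_solve_low.
have a0 : a 0%N = 0 by rewrite -ag.
have an : a n.+1 = 0 by exact: fps_approx_high.
have E := fps_comp_next h g0 a0 ag an.
by rewrite E {1}/g fps_solveE -/a mulVKf// subrK.
Qed.

Lemma fps_compinv1 h : delta_series h -> fps_compinv h 1%N != 0.
Proof.
move=> hD; have /fpsP/(_ 1%N) := fps_compinvK hD.
have [h0 h1] := hD.
have -> : fps_comp h (fps_compinv h) 1%N = h 1%N * fps_compinv h 1%N.
  by rewrite fps_coef_comp 2!big_ord_recl big_ord0 addr0 h0 mul0r add0r.
rewrite fps_coefX eqxx.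
by apply: contra_eq_neq => ->; rewrite mulr0 eq_sym oner_eq0.
Qed.

Lemma compinv_fpsK h : delta_series h -> fps_comp (fps_compinv h) h = fpsX.
Proof.
move=> hD; have [h0 h1] := hD.
set g := fps_compinv h.
have g0 : g 0%N = 0 := fps_compinv0 hD.
have gD : delta_series g by split => //; exact: fps_compinv1.
have k0 := fps_compinv0 gD.
have gk := fps_compinvK gD; set k := fps_compinv g in k0 gk.
suff -> : h = k by [].
rewrite -[LHS]fps_compXr -gk fps_compA// fps_compinvK//.
exact: fps_compXl.
Qed.

End FpsCompinv.

Section ShefferAppell.
Variable K : fieldType.

Definition fps_map (A B : Type) (phi : A -> B) (f : fps A) : fps B :=
  Fps (fun n => phi (f n)).

(* [\sum_n p_n(x) y^n / n!], a power series in [y] over the ring [K[x]] *)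
Definition poly_egf (p : nat -> {poly K}) : fps {poly K} :=
  Fps (fun n => (n`!%:R)^-1 *: p n).

(* [exp (x f(y))], for [f 0 = 0]: the series [\sum_n x^n y^n / n!] at
   [y := f y] *)
Definition fps_expx (f : fps K) : fps {poly K} :=
  fps_comp (poly_egf (fun n => 'X^n)) (fps_map polyC f).

Definition sheffer_appell (l h : fps K) (sA : nat -> {poly K}) :=
  let hi := fps_compinv h in
  fps_map polyC (fps_comp l hi * l)^-1 * fps_expx hi = poly_egf sA.

End ShefferAppell.

(* Main.v *)
Require Import Defs.
From mathcomp Require Import all_boot all_order all_algebra.
From mathcomp Require Import reals complex.
From mathcomp Require Import ring.
Import GRing.Theory.
Local Open Scope ring_scope.

(** With [D := h' o h^-1], the chain rule gives [D * (h^-1)' = 1]. Multiplying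
    the derivative of the generating function [F] by [D] therefore yields
    [D F' = (x - D l' / l - (l' o h^-1) / (l o h^-1)) F], and the recurrence
    compares the coefficients of [y^n / n!] on both sides. *)

(** * Formal differentiation of power series *)

Section FpsDeriv.
Context {K : comNzRingType}.
Implicit Types f g : fps K.

Lemma fps_coefMn f n m : (f *+ n) m = f m *+ n.
Proof. by elim: n => [|n IHn]; rewrite ?mulr0n// !mulrS fps_coefD IHn. Qed.

Lemma fps_derivD f g : fps_deriv (f + g) = fps_deriv f + fps_deriv g.
Proof. by apply/fpsP => n; rewrite /= mulrnDl. Qed.

Lemma fps_derivC (c : K) : fps_deriv (fpsC c) = 0.
Proof. by apply/fpsP => n; rewrite /= mul0rn. Qed.

Lemma fps_deriv_sum (I : Type) (r : seq I) (P : pred I) (F : I -> fps K) :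
  fps_deriv (\sum_(i <- r | P i) F i) = \sum_(i <- r | P i) fps_deriv (F i).
Proof.
elim/big_rec2: _ => [|i x y _ <-]; last by rewrite fps_derivD.
by apply/fpsP => n; rewrite /= mul0rn.
Qed.

Lemma fps_derivM f g : fps_deriv (f * g) = fps_deriv f * g + f * fps_deriv g.
Proof.
apply/fpsP => n; rewrite fps_coefD fps_coef_deriv !fps_coefM.
(* The factor [n.+1] splits as [i + (n.+1 - i)] in the [i]-th term, one share for each factor of the
   product. *)
have -> : (\sum_(i < n.+2) f i * g (n.+1 - i)%N) *+ n.+1 =
    \sum_(i < n.+2) (f i *+ i) * g (n.+1 - i)%N +
    \sum_(i < n.+2) f i * (g (n.+1 - i)%N *+ (n.+1 - i)).
  rewrite -sumrMnl -big_split /=; apply: eq_bigr => i _.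
  by rewrite mulrnAl mulrnAr -mulrnDr subnKC// -ltnS.
congr (_ + _).
  rewrite big_ord_recl mulr0n mul0r add0r; apply: eq_bigr => i _.
  by rewrite lift0 subSS.
rewrite big_ord_recr /= subnn mulr0n mulr0 addr0; apply: eq_bigr => i _ /=.
by rewrite subSn// -ltnS.
Qed.

Lemma fps_derivXn f n :
  fps_deriv (f ^+ n.+1) = fps_deriv f * f ^+ n *+ n.+1.
Proof.
elim: n => [|n IHn]; first by rewrite expr0 mulr1.
rewrite exprS fps_derivM IHn -mulrnAr mulrCA mulrnAr -exprS mulrnAr.
by rewrite [RHS]mulrS.
Qed.

Lemma fps_deriv_comp f g : g 0%N = 0 ->
  fps_deriv (fps_comp f g) = fps_comp (fps_deriv f) g * fps_deriv g.
Proof.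
(* Coefficient [n] of the derivative needs coefficient [n.+1] of the composite, hence [n.+2] terms.
   The constant term dies, leaving the [n.+1] terms of [S]. *)
move=> g0; apply/fpsP => n; rewrite fps_coef_deriv (@fps_compE _ n.+2)//.
rewrite -fps_coef_deriv fps_deriv_sum big_ord_recl.
rewrite expr0 mulr1 fps_derivC add0r.
pose S := \sum_(k < n.+1) fpsC (fps_deriv f k) * g ^+ k.
transitivity ((S * fps_deriv g) n); last first.
  by apply: (@eqfpsM _ n.+1) => // i iltn; rewrite /S -fps_compE.
congr (fps_coef _ n); rewrite mulr_suml; apply: eq_bigr => k _.
rewrite lift0 fps_derivM fps_derivC mul0r add0r fps_derivXn.
apply/fpsP => m; rewrite -mulrA !fps_coefCM fps_coefMn fps_coef_deriv.
by rewrite [g ^+ k * _]mulrC mulrnAl mulrnAr.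
Qed.

Lemma fps_derivX : fps_deriv (fpsX : fps K) = 1.
Proof.
apply/fpsP => -[|n]; rewrite fps_coef_deriv fps_coefX fps_coef1 ?mulr1n//.
by rewrite mul0rn.
Qed.

Lemma fps_deriv0E k f : fps_deriv0 k f = f k *+ k`!.
Proof.
(* The induction needs every coefficient, not only the constant one; at [n = 0] the falling
   factorial becomes [k!]. *)
rewrite /fps_deriv0; suff E n : iter k (@fps_deriv K) f n = f (n + k)%N *+ (n + k) ^_ k.
  by rewrite E ffactnn.
elim: k n => [|k IHk] n; first by rewrite addn0 ffactn0.
by rewrite iterS fps_coef_deriv IHk addSnnS -mulrnA ffactnSr addnS subSn
  ?leq_addl// addnK.
Qed.

End FpsDeriv.

(** Differentiate [f^-1 * f = 1]. Keeping [f' / f] as a factor lets the rule for logarithmic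
    derivatives of products apply. *)
Lemma fps_derivV (K : comUnitRingType) (f : fps K) : f \is a GRing.unit ->
  fps_deriv f^-1 = - (f^-1 * (fps_deriv f / f)).
Proof.
move=> fU; apply: (mulIr fU); rewrite mulNr mulrA mulrVK//.
apply/eqP; rewrite -addr_eq0 -fps_derivM mulVr//.
by rewrite fps_derivC.
Qed.

Lemma fps_logderivM (K : comUnitRingType) (f g : fps K) :
  f \is a GRing.unit -> g \is a GRing.unit ->
  fps_deriv (f * g) / (f * g) = fps_deriv f / f + fps_deriv g / g.
Proof.
move=> fU gU; rewrite fps_derivM mulrDl invrM//; congr (_ + _).
  by rewrite -mulrA (mulVKr gU).
by rewrite [f * _]mulrC -mulrA [f * _]mulrC -mulrA (mulVr fU) mulr1.
Qed.

Lemma fps_deriv_compinvK (K : fieldType) (h : fps K) : delta_series h ->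
  fps_comp (fps_deriv h) (fps_compinv h) * fps_deriv (fps_compinv h) = 1.
Proof.
by move=> hD; rewrite -fps_deriv_comp ?fps_compinv0// fps_compinvK// fps_derivX.
Qed.

Section FpsMap.
Context {K L : comNzRingType} (phi : {rmorphism K -> L}).
Implicit Types f g : fps K.

Lemma fps_mapM f g : fps_map phi (f * g) = fps_map phi f * fps_map phi g.
Proof.
apply/fpsP => n; rewrite /= rmorph_sum; apply: eq_bigr => i _.
by rewrite rmorphM.
Qed.

Lemma fps_map1 : fps_map phi 1 = 1.
Proof. by apply/fpsP => -[|n] /=; rewrite ?rmorph1 ?rmorph0. Qed.

Lemma fps_deriv_map f : fps_deriv (fps_map phi f) = fps_map phi (fps_deriv f).
Proof. by apply/fpsP => n; rewrite /= rmorphMn. Qed.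

End FpsMap.

(** * Exponential generating functions of polynomial sequences *)

Section PolyEgf.
Context {K : fieldType} (charK0 : [pchar K] =i pred0).
Implicit Types (f : fps K) (p q : nat -> {poly K}).

Let natr_eq0 n : (n%:R == 0 :> K) = (n == 0%N).
Proof. by move/pcharf0P: charK0. Qed.

Let fact_neq0 n : n`!%:R != 0 :> K.
Proof. by rewrite natr_eq0 -lt0n fact_gt0. Qed.

Lemma poly_egf_inj p q : poly_egf p = poly_egf q -> p =1 q.
Proof.
move=> /fpsP pq n; have /= := pq n; apply: scalerI.
by rewrite invr_eq0 fact_neq0.
Qed.

Lemma poly_egfD p q :
  poly_egf p + poly_egf q = poly_egf (fun n => p n + q n).
Proof. by apply/fpsP => n; rewrite /= scalerDr. Qed.

Lemma poly_egfCM (r : {poly K}) p :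
  fpsC r * poly_egf p = poly_egf (fun n => r * p n).
Proof. by apply/fpsP => n; rewrite fps_coefCM /= scalerAr. Qed.

Lemma fps_deriv_poly_egf p : fps_deriv (poly_egf p) = poly_egf (p \o S).
Proof.
apply/fpsP => n; rewrite /= -scaler_nat scalerA factS natrM.
by rewrite invfM mulrA divff ?mul1r// natr_eq0.
Qed.

(** Products of exponential generating functions are binomial convolutions: [n! / (k! (n - k)!)] is
    the binomial coefficient, and characteristic zero allows the divisions. *)
Lemma fps_map_mul_poly_egf f p :
  fps_map polyC f * poly_egf p =
  poly_egf (fun n =>
    \sum_(0 <= k < n.+1) ('C(n, k)%:R * fps_deriv0 k f) *: p (n - k)%N).
Proof.
apply/fpsP => n; rewrite fps_coefM /= big_mkord scaler_sumr.
apply: eq_bigr => -[k /=]; rewrite ltnS => kn _.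
rewrite mul_polyC !scalerA; congr (_ *: _); rewrite fps_deriv0E -mulr_natr.
rewrite -(bin_fact kn) !natrM.
have Cn0 : 'C(n, k)%:R != 0 :> K by rewrite natr_eq0 -lt0n bin_gt0.
by field; rewrite !fact_neq0 Cn0.
Qed.

(** Chain rule for [exp (x t)] at [t = f y]: shifting the sequence ['X^n] multiplies it by ['X]. *)
Lemma fps_deriv_expx f : f 0%N = 0 ->
  fps_deriv (fps_expx f) =
  fpsC 'X * fps_map polyC (fps_deriv f) * fps_expx f.
Proof.
move=> f0; rewrite fps_deriv_comp/= ?f0// fps_deriv_poly_egf fps_deriv_map.
have -> : poly_egf ((fun n => 'X^n : {poly K}) \o S) =
    fpsC 'X * poly_egf (fun n => 'X^n).
  by rewrite poly_egfCM; apply/fpsP => n /=; rewrite exprS.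
by rewrite fps_compCM mulrAC.
Qed.

Lemma sheffer_appell_deriv (h l : fps K) (sA : nat -> {poly K}) :
  delta_series h -> invertible_series l -> sheffer_appell l h sA ->
  let hi := fps_compinv h in
  let h'hi := fps_comp (fps_deriv h) hi in
  fps_map polyC h'hi * poly_egf (sA \o S) =
    fpsC 'X * poly_egf sA +
    fps_map polyC (- (h'hi * fps_deriv l / l)
                   + - (fps_comp (fps_deriv l) hi / fps_comp l hi))
    * poly_egf sA.
Proof.
move=> hD lI FE hi h'hi; have hi0 : hi 0%N = 0 := fps_compinv0 hD.
have lU : l \is a GRing.unit by rewrite fps_unitE unitfE.
have lhiU : fps_comp l hi \is a GRing.unit.
  by rewrite fps_unitE fps_comp0 unitfE.
have h'hiK : h'hi * fps_deriv hi = 1 := fps_deriv_compinvK _ _ hD.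
rewrite -fps_deriv_poly_egf -FE fps_derivM fps_deriv_map fps_deriv_expx//.
set W := (_ * l)^-1; set E := fps_expx hi; set B := - _ + - _.
(* [W] is the prefactor [1 / (l(h^-1) l)]. In its logarithmic derivative, the term from [l(h^-1)]
   carries a factor [(h^-1)'], which [h'hi] cancels; the term from [l] keeps [h'hi]. *)
have W'E : h'hi * fps_deriv W = B * W.
  rewrite /W fps_derivV ?unitrM ?lhiU// fps_logderivM// fps_deriv_comp// -/W.
  by rewrite /B -[fps_comp _ hi / _ in RHS]mul1r -h'hiK; ring.
rewrite mulrDr mulrA -fps_mapM W'E fps_mapM addrC -!mulrA; congr (_ + _).
(* The derivative of the exponential contributes [x (h^-1)'], and [h'hi] again cancels [(h^-1)']. *)
by rewrite -[RHS]mul1r -(fps_map1 (@polyC K)) -h'hiK fps_mapM; ring.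
Qed.

End PolyEgf.

Theorem theorem3 (R : realType) (h l : fps R[i]) (sA : nat -> {poly R[i]}) :
  delta_series h -> invertible_series l -> sheffer_appell l h sA ->
  let hi := fps_compinv h in
  let h' := fps_deriv h in
  let l' := fps_deriv l in
  let a k := fps_deriv0 k (fps_comp h' hi) in
  let b k := fps_deriv0 k (- (fps_comp h' hi * l' / l)) in
  let c k := fps_deriv0 k (- (fps_comp l' hi / fps_comp l hi)) in
  forall n : nat,
    a 0%N *: sA n.+1 =
      'X * sA n
      + \sum_(0 <= k < n.+1) ('C(n, k)%:R * (b k + c k)) *: sA (n - k)%N
      - \sum_(1 <= k < n.+1) ('C(n, k)%:R * a k) *: sA (n.+1 - k)%N.
Proof.
move=> hD lI FE hi h' l' a b c n.
have char0 : [pchar R[i]] =i pred0 by exact: Num.Theory.pchar_num.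
have /= := sheffer_appell_deriv char0 _ _ _ hD lI FE.
rewrite poly_egfCM !(fps_map_mul_poly_egf char0) poly_egfD.
move=> /(poly_egf_inj char0 _ _)/(_ n).
(* The [k = 0] term of the convolution on the left is [a 0 *: sA n.+1]; the remaining terms move to
   the other side. *)
move=> /=; rewrite [X in X = _ -> _]big_ltn// bin0 mul1r subn0 => E.
apply/eqP; rewrite eq_sym subr_eq eq_sym; apply/eqP.
transitivity ('X * sA n + \sum_(0 <= k < n.+1)
  ('C(n, k)%:R * fps_deriv0 k (- (fps_comp h' hi * l' / l)
     + - (fps_comp l' hi / fps_comp l hi))) *: sA (n - k)%N).
  rewrite -E; congr (_ + _); apply: eq_big_nat => k /andP[_ kn].
  by rewrite subSn.
congr (_ + _); apply: eq_bigr => k _.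
by rewrite /b /c !fps_deriv0E fps_coefD mulrnDl.
Qed.
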